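(* Let $R=k[x_0,\ldots,x_m]$ and $S=k[y_0,\ldots,y_n]$ be polynomial rings over a field $k$ (in disjoint sets of indeterminates), and let $I$ and $J$ be two ideals of $R$ and $S$ respectively. If $I$ and $J$ are normal ideals generated by square-free monomials of the same degree $t\ge 2$, then their join $I\ast J$ is a normal ideal of $k[x_0,\ldots,x_m,y_0,\ldots,y_n]$.
   Context: For monomial ideals $I\subset k[x_0,\ldots,x_m]$ and $J\subset k[y_0,\ldots,y_n]$, the join is the ideal of $k[x_0,\ldots,x_m,y_0,\ldots,y_n]$ $$I\ast J=I+J+K,\qquad K=(x_iy_j\mid 0\le i\le m,\ 0\le j\le n),$$ where $I$ and $J$ stand for the ideals they generate in the larger ring. An ideal is normal if all its powers $I^q$, $q\ge1$, are integrally closed (complete). *)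

(* Defs.v *)
From mathcomp Require Import all_boot all_order all_algebra.
From mathcomp Require Import classical_sets.
From mathcomp Require Import mpoly.

Set Implicit Arguments.
Unset Strict Implicit.
Unset Printing Implicit Defensive.

Import GRing.Theory.
Local Open Scope classical_set_scope.
Local Open Scope ring_scope.

Section Ideals.
Variable A : comNzRingType.
Implicit Types (I J G : set A).

(* Ideals need not be proper, unlike those of ring_quotient's
   idealr_closed. *)
Definition is_ideal I : Prop :=
  [/\ I 0, (forall x y, I x -> I y -> I (x + y))
    & forall a x, I x -> I (a * x)].

Definition ideal_gen G : set A := smallest is_ideal G.

Definition ideal_add I J : set A := [set x + y | x in I & y in J].

(* In particular I^0 = (1), the whole ring. *)
Definition ideal_pow I (q : nat) : set A :=
  ideal_gen [set \prod_(i < q) f i | f in [set f : 'I_q -> A |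
                                           forall i, I (f i)]].

Definition integral_closure I : set A :=
  [set x | exists (d : nat) (a : nat -> A),
    [/\ (0 < d)%N,
        (forall i, (1 <= i <= d)%N -> ideal_pow I i (a i))
      & x ^+ d + \sum_(1 <= i < d.+1) a i * x ^+ (d - i) = 0]].

Definition integrally_closed I : Prop := integral_closure I = I.

Definition normal_ideal I : Prop :=
  forall q : nat, (1 <= q)%N -> integrally_closed (ideal_pow I q).

End Ideals.

Section MonomialIdeals.
Variable k : fieldType.

Definition squarefree_mnm n (e : 'X_{1..n}) : Prop :=
  forall i : 'I_n, (e i <= 1)%N.

Definition gen_by_squarefree n (t : nat) (I : set {mpoly k[n]}) : Prop :=
  exists2 G : set 'X_{1..n},
    (forall e, G e -> squarefree_mnm e /\ mdeg e = t)
    & I = ideal_gen [set 'X_[e] | e in G].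

(* k[x_0..x_m, y_0..y_n] is {mpoly k[m.+1 + n.+1]}: the x_i are the
   first m + 1 variables, the y_j the last n + 1. *)
Section Join.
Variables m n : nat.
Local Notation T := {mpoly k[m.+1 + n.+1]}.

Definition xvar (i : 'I_m.+1) : T := 'X_(lshift n.+1 i).
Definition yvar (j : 'I_n.+1) : T := 'X_(rshift m.+1 j).

Definition xembed (p : {mpoly k[m.+1]}) : T :=
  p \mPo [tuple xvar i | i < m.+1].
Definition yembed (p : {mpoly k[n.+1]}) : T :=
  p \mPo [tuple yvar j | j < n.+1].

Definition join_ideal (I : set {mpoly k[m.+1]}) (J : set {mpoly k[n.+1]}) :
    set T :=
  ideal_add
    (ideal_add (ideal_gen (xembed @` I)) (ideal_gen (yembed @` J)))
    (ideal_gen [set xvar i * yvar j | i in setT & j in setT]).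

End Join.
End MonomialIdeals.

(* Main.v *)
(* Write G^p for the monomials divisible by a product of p generators. For an
   ideal generated by monomials of bounded degree, normality means that
   s a in G^(q s) implies a in G^q: if f is integral over the q-th power then
   f^N lies in the q(N-d)-th power for all N and some d, which passes to the
   leading monomial a of f; Dickson's lemma removes the defect d, and one
   subtracts the leading term.
   For the join, let s(a,b) be divisible by a product of p1 generators of I, p2
   of J and p3 of K with p1 + p2 + p3 = q s, and say A = |a| <= B = |b|. With
   r = q - A, degree counting gives s r <= p2, so b is in J^r by normality of J,
   and t r + A <= B, so the rest of b has degree at least A and pairs with a to
   give A generators of K. *)
Require Import Defs.
From mathcomp Require Import all_boot all_order all_algebra.
From mathcomp Require Import boolp classical_sets.
From mathcomp Require Import mpoly.
From mathcomp Require Import zify.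

Set Implicit Arguments.
Unset Strict Implicit.
Unset Printing Implicit Defensive.

Import GRing.Theory.
Local Open Scope classical_set_scope.
Local Open Scope ring_scope.

(** * Generated ideals, their sums and powers *)

Section Ideals.
Variable A : comNzRingType.
Implicit Types (I J G Q : set A).

Lemma ideal_gen_ideal G : is_ideal (ideal_gen G).
Proof.
split=> [X [[]] //|x y Gx Gy X XP|a x Gx X XP]; case: (XP) => -[_ XD XM] _.
- by apply: XD; [apply: Gx|apply: Gy].
- by apply: XM; apply: Gx.
Qed.

Lemma ideal_add_ideal I J : is_ideal I -> is_ideal J -> is_ideal (ideal_add I J).
Proof.
case=> I0 ID IM [J0 JD JM]; split.
- by exists 0 => //; exists 0 => //; rewrite addr0.
- move=> _ _ [x Ix [y Jy <-]] [x' Ix' [y' Jy' <-]].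
  by exists (x + x'); [exact: ID|exists (y + y'); [exact: JD|rewrite addrACA]].
- move=> a _ [x Ix [y Jy <-]].
  by exists (a * x); [exact: IM|exists (a * y); [exact: JM|rewrite mulrDr]].
Qed.

Lemma ideal_add_subl I J : is_ideal J -> I `<=` ideal_add I J.
Proof. by case=> J0 _ _ x Ix; exists x => //; exists 0 => //; rewrite addr0. Qed.

Lemma ideal_add_subr I J : is_ideal I -> J `<=` ideal_add I J.
Proof. by case=> I0 _ _ x Jx; exists 0 => //; exists x => //; rewrite add0r. Qed.

Lemma ideal_add_lub I J Q :
  is_ideal Q -> I `<=` Q -> J `<=` Q -> ideal_add I J `<=` Q.
Proof. by case=> _ QD _ IQ JQ _ [x Ix [y Jy <-]]; apply: QD; auto. Qed.

Lemma ideal_preimage (B : comNzRingType) (f : {rmorphism A -> B}) (Q : set B) :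
  is_ideal Q -> is_ideal (f @^-1` Q).
Proof.
case=> Q0 QD QM; split=> [|x y Qx Qy|a x Qx] /=.
- by rewrite /preimage /= rmorph0.
- by rewrite /preimage /= rmorphD; apply: QD.
- by rewrite /preimage /= rmorphM; apply: QM.
Qed.

Lemma ideal_sum Q (T : eqType) (r : seq T) (F : T -> A) :
  is_ideal Q -> (forall i, i \in r -> Q (F i)) -> Q (\sum_(i <- r) F i).
Proof.
case=> Q0 QD _; elim: r => [|i r IHr] QF; first by rewrite big_nil.
rewrite big_cons; apply: QD; first by apply: QF; rewrite mem_head.
by apply: IHr => j rj; apply: QF; rewrite inE rj orbT.
Qed.

Lemma ideal_opp Q x : is_ideal Q -> Q x -> Q (- x).
Proof. by case=> _ _ QM Qx; rewrite -mulN1r; apply: QM. Qed.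

Lemma ideal_pow_ideal Q p : is_ideal (ideal_pow Q p).
Proof. exact: ideal_gen_ideal. Qed.

Lemma ideal_pow0 Q x : ideal_pow Q 0 x.
Proof.
rewrite -[x]mulr1; case: (ideal_pow_ideal Q 0) => _ _; apply.
by apply: sub_gen_smallest; exists (fun=> 0) => [[]//|]; rewrite big_ord0.
Qed.

Lemma ideal_powS Q p x y : Q x -> ideal_pow Q p y -> ideal_pow Q p.+1 (x * y).
Proof.
move=> Qx; move: y; apply: smallest_sub.
  case: (ideal_pow_ideal Q p.+1) => P0 PD PM; split.
  - by rewrite /mkset mulr0.
  - by move=> y z Py Pz; rewrite /mkset mulrDr; apply: PD.
  - by move=> a y Py; rewrite /mkset mulrCA; apply: PM.
move=> _ [f Qf <-]; apply: sub_gen_smallest.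
(* The family [f] with [x] prepended at index [ord0]. *)
exists (fun i => oapp f x (unlift ord0 i)).
  by move=> i; case: unliftP => [j|] _ //=.
rewrite big_ord_recl unlift_none; congr (_ * _).
by apply: eq_bigr => i _; rewrite liftK.
Qed.

End Ideals.

(** * Dickson's lemma for sequences of tuples of naturals *)

Section Dickson.
Implicit Types f : nat -> nat.

(** Each new index is a point where [f] is minimal on the tail after the previous index, so no later
    value is smaller. *)
Lemma nondecreasing_subsequence f : exists2 u : nat -> nat,
  {homo u : i j / (i < j)%N} & {homo (f \o u) : i j / (i <= j)%N}.
Proof.
have argmin a : exists b, (a <= b)%N /\ forall c, (a <= c)%N -> (f b <= f c)%N.
  have ex : exists v, `[< exists2 b, (a <= b)%N & f b = v >].
    by exists (f a); apply/asboolP; exists a.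
  have [v /asboolP[b ab fb] vmin] := ex_minnP ex.
  by exists b; split=> // c ac; rewrite fb; apply/vmin/asboolP; exists c.
have [g gP] := choice argmin.
pose u := fix u i := if i is j.+1 then g (u j).+1 else g 0%N.
have uP i c : (u i <= c)%N -> (f (u i) <= f c)%N.
  case: i => [|i] /= uc; apply: (gP _).2 => //.
  by apply: leq_trans uc; apply: (gP _).1.
have uS i : (u i < u i.+1)%N by apply: (gP _).1.
exists u; first by apply: homo_ltn uS => j i k; apply: ltn_trans.
apply: homo_leq => [//|j i k|i]; first exact: leq_trans.
by apply: uP; apply: ltnW.
Qed.

(** Subsequences are extracted one coordinate at a time; a further extraction keeps the earlier
    coordinates monotone. *)
Lemma dickson_seq (T : eqType) (r : seq T) (F : T -> nat -> nat) :
  exists i j, (i < j)%N /\ forall x, x \in r -> (F x i <= F x j)%N.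
Proof.
suff [u u_inc uF] : exists2 u : nat -> nat, {homo u : i j / (i < j)%N} &
    forall x, x \in r -> {homo (F x \o u) : i j / (i <= j)%N}.
  by exists (u 0%N), (u 1%N); split=> [|x /uF]; [apply: u_inc|apply].
elim: r => [|x r [u u_inc uF]]; first by exists id.
have [v v_inc vF] := nondecreasing_subsequence (F x \o u).
exists (u \o v) => [i j ij|y]; first exact/u_inc/v_inc.
rewrite inE => /predU1P[-> //|ry] i j ij; apply: (uF y ry).
by exact: ltnW_homo.
Qed.

End Dickson.

(** * Products of generators, in terms of exponents *)

Section MonomialPowers.
Variable n : nat.
Implicit Types (G : set 'X_{1..n}) (e a b : 'X_{1..n}) (s : seq 'X_{1..n}).

(** The G^p of the overview: products become sums of exponents, divisibility becomes [<=], and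
    generators may repeat in [s]. *)
Definition mnm_pow G p e :=
  exists s, [/\ size s = p, (forall g, g \in s -> G g)
    & (\sum_(g <- s) g <= e)%MM].

Lemma mnm_pow0 G e : mnm_pow G 0 e.
Proof.
exists [::]; split=> //; rewrite big_nil.
by apply/mnm_lepP=> i; rewrite mnm0E.
Qed.

Lemma mnm_pow_gen G g : G g -> mnm_pow G 1 g.
Proof.
move=> Gg; exists [:: g]; split=> // [h|]; last by rewrite big_seq1 lepm_refl.
by rewrite inE => /eqP->.
Qed.

Lemma mnm_pow_sum G s :
  (forall g, g \in s -> G g) -> mnm_pow G (size s) (\sum_(g <- s) g)%MM.
Proof. by move=> Gs; exists s; split=> //; apply: lepm_refl. Qed.

Lemma mnm_pow_le G p q a b :
  (p <= q)%N -> (a <= b)%MM -> mnm_pow G q a -> mnm_pow G p b.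
Proof.
move=> pq ab [s [sz Gs sa]]; exists (take p s); split.
- by apply: size_takel; rewrite sz.
- by move=> g /mem_take/Gs.
- apply: lepm_trans ab; apply: lepm_trans sa.
  by rewrite -{2}(cat_take_drop p s) big_cat lem_addr.
Qed.

Lemma mnm_powD G p q a b :
  mnm_pow G p a -> mnm_pow G q b -> mnm_pow G (p + q) (a + b)%MM.
Proof.
move=> [s [<- Gs sa]] [r [<- Gr rb]]; exists (s ++ r); split.
- exact: size_cat.
- by move=> g; rewrite mem_cat => /orP[/Gs|/Gr].
- rewrite big_cat; apply/mnm_lepP=> i; rewrite !mnmDE.
  by apply: leq_add; apply/mnm_lepP.
Qed.

(* A monomial power-integral up to a bounded defect is integral: two comparable
   factorisations (exist by Dickson) have a genuine factorisation as quotient. *)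
Lemma mnm_pow_almost_integral D G q d a :
  (forall g, G g -> (mdeg g <= D)%N) ->
  (forall l, mnm_pow G (q * l) (a *+ (d + l))) ->
  exists2 s, (0 < s)%N & mnm_pow G (q * s) (a *+ s).
Proof.
move=> GD /choice[f fP].
pose sm l := (\sum_(g <- f l) g)%MM.
(* Compared are the multiplicities of the generators in [f l] and the exponents of the cofactor of
   their product in [a *+ (d + l)]. *)
pose F (x : 'X_{1..n} + 'I_n) l := match x with
  | inl g => count_mem g (f l) | inr i => ((a *+ (d + l))%MM i - sm l i)%N end.
(* Finitely many coordinates suffice, since generators have degree at most [D]. *)
pose r : seq ('X_{1..n} + 'I_n) :=
  [seq inl (bmnm b) | b : 'X_{1..n < D.+1}] ++ [seq inr i | i : 'I_n].
have [i [j [ij ijF]]] := dickson_seq r F.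
have /count_subseqP[s1 s1j is1] :
    forall g, (count_mem g (f i) <= count_mem g (f j))%N.
  move=> g; have [gi|/count_memPn-> //] := boolP (g \in f i).
  have [_ Gi _] := fP i.
  have gD : (mdeg g < D.+1)%N by apply/GD/Gi.
  apply: (ijF (inl g)); rewrite mem_cat; apply/orP; left.
  by apply/mapP; exists (BMultinom gD); rewrite ?mem_enum.
have [s2 js2] := perm_to_subseq s1j.
have jE : perm_eq (f j) (f i ++ s2) by rewrite (perm_trans js2) // perm_cat2r perm_sym.
have [szi Gi lei] := fP i; have [szj Gj lej] := fP j.
exists (j - i)%N; first by rewrite subn_gt0.
exists s2; split.
- by rewrite mulnBr -szi -szj (perm_size jE) size_cat addKn.
- by move=> g gs; apply: Gj; rewrite (perm_mem jE) mem_cat gs orbT.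
(* The cofactor at [j] dominates the one at [i], so the extra factors [s2] multiply to a divisor of
   [a *+ (j - i)]. *)
- apply/mnm_lepP => x.
  have /= := ijF (inr x); rewrite mem_cat map_f ?mem_enum ?orbT // => /(_ isT).
  have := mnm_lepP lei x; have := mnm_lepP lej x.
  rewrite !mulmnE /sm (perm_big _ jE) big_cat mnmDE /=.
  nia.
Qed.

End MonomialPowers.

(** * Powers of monomial ideals and the monomial criterion for normality *)

Section MonomialIdeals.
Variables (k : fieldType) (n : nat).
Implicit Types (G : set 'X_{1..n}) (e a b : 'X_{1..n}) (f h : {mpoly k[n]}).

(** By [ideal_pow_genE] this is the [p]-th power of the ideal generated by the monomials of [G]. *)
Definition mnm_ideal G p : set {mpoly k[n]} :=
  [set f | forall e, e \in msupp f -> mnm_pow G p e].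

Definition mpolyXs G : set {mpoly k[n]} := [set 'X_[e] | e in G].

Lemma mnm_idealM G p q f h :
  mnm_ideal G p f -> mnm_ideal G q h -> mnm_ideal G (p + q) (f * h).
Proof.
move=> fp hq e /msuppM_le/allpairsP[[a b] /= [fa hb ->]].
by apply: mnm_powD; [apply: fp|apply: hq].
Qed.

Lemma mnm_ideal_all G f : mnm_ideal G 0 f.
Proof. by move=> e _; apply: mnm_pow0. Qed.

Lemma mnm_ideal_le G p q : (p <= q)%N -> mnm_ideal G q `<=` mnm_ideal G p.
Proof. by move=> pq f fq e /fq; apply: mnm_pow_le (lepm_refl e). Qed.

Lemma mnm_ideal_ideal G p : is_ideal (mnm_ideal G p).
Proof.
split=> [e|f h fp hp e|c f fp]; first by rewrite msupp0.
- by move/msuppD_le; rewrite mem_cat => /orP[/fp|/hp].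
- by rewrite -[p]add0n; apply: mnm_idealM => //; apply: mnm_ideal_all.
Qed.

Lemma mnm_idealX G p e : mnm_pow G p e -> mnm_ideal G p 'X_[e].
Proof. by move=> pe _ /mem_msuppXP <-. Qed.

Lemma mnm_ideal_expr G p f i : mnm_ideal G p f -> mnm_ideal G (p * i) (f ^+ i).
Proof.
move=> fp; elim: i => [|i IHi]; first by rewrite muln0; apply: mnm_ideal_all.
by rewrite mulnS exprS; apply: mnm_idealM.
Qed.

Lemma ideal_pow_mnm_ideal G p i :
  ideal_pow (mnm_ideal G p) i `<=` mnm_ideal G (p * i).
Proof.
apply: smallest_sub; first exact: mnm_ideal_ideal.
move=> _ [F FG <-]; elim: i F FG => [|i IHi] F FG.
  by rewrite muln0; apply: mnm_ideal_all.
rewrite big_ord_recl mulnS; apply: mnm_idealM; first exact: FG.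
by apply: IHi => j; apply: FG.
Qed.

Lemma ideal_pow_genE G p : ideal_pow (ideal_gen (mpolyXs G)) p = mnm_ideal G p.
Proof.
apply/seteqP; split.
  have G1 : ideal_gen (mpolyXs G) `<=` mnm_ideal G 1.
    apply: smallest_sub; first exact: mnm_ideal_ideal.
    by move=> _ [e Ge <-]; apply/mnm_idealX/mnm_pow_gen.
  rewrite -{2}[p]mul1n; apply: subset_trans (@ideal_pow_mnm_ideal G 1 p).
  apply: sub_smallest2r; first exact: ideal_gen_ideal.
  by move=> _ [F FG <-]; exists F => // i; apply: G1; apply: FG.
have PI := ideal_pow_ideal (ideal_gen (mpolyXs G)) p.
move=> f fp; rewrite [f]mpolyE; apply: ideal_sum => // e /fp[s [sz Gs se]].
rewrite -mul_mpolyC -(submK se) mpolyXD mulrA.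
case: PI => _ _; apply; elim: s p Gs {se fp} sz => [|g s IHs] p Gs <-.
  exact: ideal_pow0.
rewrite big_cons mpolyXD; apply: ideal_powS.
  by apply: sub_gen_smallest; exists g => //; apply/Gs/mem_head.
by apply: IHs => // h hs; apply: Gs; rewrite inE hs orbT.
Qed.

(** A list of [q * s] generators is cut into [s] blocks of length [q]; the cofactor is carried along
    to the end. *)
Lemma ideal_pow_mnm_idealX G q s e :
  mnm_pow G (q * s) e -> ideal_pow (mnm_ideal G q) s 'X_[e].
Proof.
elim: s e => [|s IHs] e; first by move=> _; apply: ideal_pow0.
rewrite mulnS => -[r [sz Gr re]].
have szq : size (take q r) = q by rewrite size_takel // sz leq_addr.
have szd : size (drop q r) = (q * s)%N by rewrite size_drop sz addKn.
have -> : e = (\sum_(g <- take q r) g +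
    (\sum_(g <- drop q r) g + (e - \sum_(g <- r) g)))%MM.
  by rewrite addmA -big_cat /= cat_take_drop addmC submK.
rewrite mpolyXD; apply: ideal_powS.
  apply: mnm_idealX; rewrite -{1}szq; apply: mnm_pow_sum => g /mem_take; exact: Gr.
apply: IHs; apply: (mnm_pow_le (leqnn _) (lem_addr _ _)).
by rewrite -szd; apply: mnm_pow_sum => g /mem_drop; apply: Gr.
Qed.

Lemma mpolyXn_integral (Q : set {mpoly k[n]}) s a :
  (0 < s)%N -> ideal_pow Q s ('X_[a] ^+ s) -> integral_closure Q 'X_[a].
Proof.
move=> s_gt0 Qs.
(* The equation is X^s - x^s = 0 with x = ['X_[a]]; the constant term is the coefficient of index
   [s]. *)
exists s, (fun i => if i == s then - 'X_[a] ^+ s else 0); split=> //.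
  move=> i _; case: eqP => [->|_]; last by case: (ideal_pow_ideal Q i).
  exact: ideal_opp (ideal_pow_ideal _ _) Qs.
rewrite big_nat_recr //= eqxx subnn mulr1 big_nat big1 ?add0r ?subrr //.
by move=> i /andP[_ /ltn_eqF ->]; rewrite mul0r.
Qed.

(** With [d] the degree of the equation, multiplying by [f ^+ (N - d)] expresses [f ^+ N] through
    the [a i * f ^+ (N - i)], and [a i] makes up for the [i] missing factors. For [N <= d] the
    truncated exponent is 0. *)
Lemma integral_pow_defect G q f : integral_closure (mnm_ideal G q) f ->
  exists d, forall N, mnm_ideal G (q * (N - d)) (f ^+ N).
Proof.
move=> [d [a [d_gt0 aQ f_eq]]]; exists d => N.
elim/ltn_ind: N => N IHN; have [Nd|dN] := leqP N d.
  by rewrite (eqP Nd) muln0; apply: mnm_ideal_all.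
have -> : f ^+ N = f ^+ d * f ^+ (N - d) by rewrite -exprD subnKC // ltnW.
rewrite -[f ^+ d]opprK (addr0_eq f_eq) mulNr.
apply: (ideal_opp (Q := mnm_ideal G _)); first exact: mnm_ideal_ideal.
rewrite big_distrl /=.
apply: (ideal_sum (Q := mnm_ideal G _)); first exact: mnm_ideal_ideal.
move=> i; rewrite mem_index_iota => /andP[i_gt0 id].
rewrite -mulrA -exprD.
apply: (@mnm_ideal_le G _ (q * i + q * (d - i + (N - d) - d))).
  by rewrite -mulnDr leq_mul2l; apply/orP; right; lia.
apply: mnm_idealM; first by apply: ideal_pow_mnm_ideal; apply: aQ; rewrite i_gt0.
by apply: IHN; lia.
Qed.

(* The leading exponent of f ^+ N is N times that of f, which gives membership
   of the leading term; subtracting it keeps the bounded defect. *)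
Lemma mnm_ideal_pow_defect G D q d f :
  (forall g, G g -> (mdeg g <= D)%N) ->
  (forall s a, (0 < s)%N -> mnm_pow G (q * s) (a *+ s)%MM -> mnm_pow G q a) ->
  (forall N, mnm_ideal G (q * (N - d)) (f ^+ N)) -> mnm_ideal G q f.
Proof.
move=> GD Gq; have [r] := ubnP (size (msupp f)).
elim: r f => // r IHr f fr fN; have [->|f_neq0] := eqVneq f 0.
  by case: (mnm_ideal_ideal G q).
pose a := mlead f; pose u := f@_a *: 'X_[a] : {mpoly k[n]}.
have fa : a \in msupp f := mlead_supp f_neq0.
have uq : mnm_ideal G q u.
  rewrite /u -mul_mpolyC; case: (mnm_ideal_ideal G q) => _ _; apply.
  apply: mnm_idealX.
  have [|s s_gt0 sa] := @mnm_pow_almost_integral n D G q d a GD; last exact: Gq sa.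
  (* For [N = d + l] the defect leaves exactly the exponent [q * l]. *)
  move=> l; rewrite -{1}(addKn d l); apply: fN.
  by rewrite -mleadX // mlead_supp // expf_neq0.
rewrite -(subrK u f); case: (mnm_ideal_ideal G q) => _ QD _; apply: QD => //.
apply: IHr => [|N].
  rewrite (perm_size (msupp_rem f a)) size_rem //.
  by case: (msupp f) fa fr.
(* Powers of [u] have no defect, so each binomial term [f ^+ (N - i) * (- u) ^+ i] loses at most
   [d]. *)
rewrite exprDn.
apply: (ideal_sum (Q := mnm_ideal G _)); first exact: mnm_ideal_ideal.
move=> i _; rewrite -mulr_natl; case: (mnm_ideal_ideal G (q * (N - d))) => _ _; apply.
have uiq : mnm_ideal G (q * i) ((- u) ^+ i).
  apply: mnm_ideal_expr; apply: (ideal_opp (Q := mnm_ideal G q)) => //.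
  exact: mnm_ideal_ideal.
apply: mnm_ideal_le (mnm_idealM (fN _) uiq).
by rewrite -mulnDr leq_mul2l; apply/orP; right; case: i {uiq} => /= i _; lia.
Qed.

(** Forward, the premise makes ['X_[a]] integral over the [q]-th power. Backward, an integral
    element has bounded defect, which the criterion removes. *)
Lemma normal_ideal_mnmP G D : (forall g, G g -> (mdeg g <= D)%N) ->
  normal_ideal (ideal_gen (mpolyXs G)) <->
  (forall q s a, (0 < q)%N -> (0 < s)%N ->
     mnm_pow G (q * s) (a *+ s)%MM -> mnm_pow G q a).
Proof.
move=> GD; split=> [Gn q s a q_gt0 s_gt0 sa|Gn q q_gt0].
  have := Gn q q_gt0; rewrite ideal_pow_genE => Gq.
  have aq : mnm_ideal G q 'X_[a].
    rewrite -Gq; apply: (@mpolyXn_integral _ s) => //.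
    by rewrite mpolyXn; apply: ideal_pow_mnm_idealX.
  by apply: aq; rewrite msuppX mem_head.
rewrite ideal_pow_genE; apply/seteqP; split.
  move=> f /integral_pow_defect[d fN].
  by apply: mnm_ideal_pow_defect GD _ fN => s a; apply: Gn.
move=> f fq; exists 1%N, (fun=> - f); split=> //.
  move=> i /andP[i1 i2]; have -> : i = 1%N by lia.
  apply: (ideal_opp (Q := ideal_pow _ _)); first exact: ideal_pow_ideal.
  by rewrite -[f]mulr1; apply: ideal_powS => //; apply: ideal_pow0.
by rewrite big_nat1 expr1 subnn expr0 mulr1 subrr.
Qed.

End MonomialIdeals.

(** * Renaming of variables on exponents *)

Section MultinomRenaming.
Variables m n : nat.
Implicit Types (phi : 'I_m -> 'I_n) (a b : 'X_{1..m}) (e : 'X_{1..n}).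

Definition mnm_push phi a : 'X_{1..n} := (\sum_(i < m) U_(phi i) *+ a i)%MM.

Definition mnm_pull phi e : 'X_{1..m} := [multinom e (phi i) | i < m].

Lemma mnm_pushE phi a j : mnm_push phi a j = (\sum_(i < m | phi i == j) a i)%N.
Proof.
rewrite mnm_sumE [RHS]big_mkcond; apply: eq_bigr => i _.
by rewrite mulmnE mnm1E; case: eqP => _; rewrite ?mul1n ?mul0n.
Qed.

Lemma mnm_pushD phi : {morph mnm_push phi : a b / (a + b)%MM}.
Proof.
move=> a b; apply/mnmP=> j; rewrite mnmDE !mnm_pushE -big_split /=.
by apply: eq_bigr => i _; rewrite mnmDE.
Qed.

Lemma mnm_pushU phi i : mnm_push phi U_(i)%MM = U_(phi i)%MM.
Proof.
apply/mnmP=> j; rewrite mnm_pushE mnm1E; case: eqP => [<-|ij].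
  rewrite (bigD1 i) //= mnm1E eqxx big1 // => l /andP[_ /negPf li].
  by rewrite mnm1E eq_sym li.
by rewrite big1 // => l /eqP lj; rewrite mnm1E; case: eqP lj => // <-.
Qed.

Lemma mnm_pushX (k : fieldType) phi a :
  'X_[mnm_push phi a] = \prod_(i < m) 'X_(phi i) ^+ a i :> {mpoly k[n]}.
Proof.
rewrite (big_morph _ (@mpolyXD n k) (mpolyX0 n k)).
by apply: eq_bigr => i _; rewrite mpolyXn.
Qed.

Lemma mdeg_push phi a : mdeg (mnm_push phi a) = mdeg a.
Proof.
by rewrite mdeg_sum mdegE; apply: eq_bigr => i _; rewrite mdegMn mdeg1 mul1n.
Qed.

Lemma mnm_pullD phi : {morph mnm_pull phi : a b / (a + b)%MM}.
Proof. by move=> a b; apply/mnmP=> i; rewrite !(mnmDE, mnmE). Qed.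

Lemma mnm_pullMn phi e s : mnm_pull phi (e *+ s)%MM = (mnm_pull phi e *+ s)%MM.
Proof. by apply/mnmP=> i; rewrite !(mulmnE, mnmE). Qed.

Lemma mnm_pull_le phi e e' :
  (e <= e')%MM -> (mnm_pull phi e <= mnm_pull phi e')%MM.
Proof. by move/mnm_lepP=> ee'; apply/mnm_lepP=> i; rewrite !mnmE. Qed.

Lemma mnm_pushK phi : injective phi -> cancel (mnm_push phi) (mnm_pull phi).
Proof.
move=> phi_inj a; apply/mnmP=> i; rewrite mnmE mnm_pushE.
by under eq_bigl => j do rewrite (inj_eq phi_inj); rewrite big_pred1_eq.
Qed.

End MultinomRenaming.

Lemma mnm_pull_push0 m n p (phi : 'I_m -> 'I_n) (psi : 'I_p -> 'I_n) c :
  (forall i j, phi i != psi j) -> mnm_pull phi (mnm_push psi c) = 0%MM.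
Proof.
move=> neq; apply/mnmP=> i; rewrite mnmE mnm0E mnm_pushE big_pred0 // => j.
by rewrite eq_sym; apply/negbTE.
Qed.

Lemma mdeg_le n (a b : 'X_{1..n}) : (a <= b)%MM -> (mdeg a <= mdeg b)%N.
Proof. by move=> ab; rewrite -(submK ab) mdegD leq_addl. Qed.

Lemma mnm_eq_addU n (a : 'X_{1..n}) :
  (0 < mdeg a)%N -> exists i b, a = (U_(i) + b)%MM.
Proof.
move=> a_gt0; have [i ai|a0] := pickP (fun i => a i != 0%N).
  by exists i, (a - U_(i))%MM; rewrite addmC submK // lep1mP.
by rewrite mdegE big1 // in a_gt0 => i _; apply/eqP/negbFE/a0.
Qed.

(** * Pairing variables from two blocks *)

Section Cross.
Variables (m n p : nat) (phi : 'I_m -> 'I_p) (psi : 'I_n -> 'I_p).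
Variables (G : set 'X_{1..p}).
Hypothesis crossG : forall i j, G (U_(phi i) + U_(psi j))%MM.

(** Each variable of [a] is paired with one of [c], and every pair is a generator. *)
Lemma mnm_pow_cross a c : (mdeg a <= mdeg c)%N ->
  mnm_pow G (mdeg a) (mnm_push phi a + mnm_push psi c)%MM.
Proof.
move: {2}(mdeg a) (erefl (mdeg a)) => d; elim: d a c => [|d IHd] a c da ac.
  by rewrite da; apply: mnm_pow0.
have [|i [a' aE]] := @mnm_eq_addU _ a; first by rewrite da.
have [|j [c' cE]] := @mnm_eq_addU _ c; first by apply: leq_trans ac; rewrite da.
subst a c; move: da ac; rewrite !mdegD !mdeg1 !mnm_pushD !mnm_pushU => -[da] ac.
rewrite Monoid.mulmACA; apply: mnm_powD; first exact/mnm_pow_gen/crossG.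
exact: IHd.
Qed.

(** Removing [r] generators of degree [t] from [b] leaves degree at least [mdeg a], enough to pair
    off [a]. The renamings stay abstract so that x and y can exchange roles. *)
Lemma mnm_pow_push_cross (H : set 'X_{1..n}) t r a b :
  (forall g, H g -> mdeg g = t /\ G (mnm_push psi g)) ->
  mnm_pow H r b -> (t * r + mdeg a <= mdeg b)%N ->
  mnm_pow G (r + mdeg a) (mnm_push phi a + mnm_push psi b)%MM.
Proof.
move=> HG [s [sz Hs sb]] ab.
have degs : mdeg (\sum_(g <- s) g)%MM = (t * r)%N.
  rewrite mdeg_sum -sz; elim: s Hs {sz sb} => [|g s IHs] Hs.
    by rewrite big_nil muln0.
  rewrite big_cons (HG _ (Hs _ _)).1 ?mem_head // IHs ?mulnS // => h hs.
  by apply: Hs; rewrite inE hs orbT.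
have Gs : mnm_pow G r (mnm_push psi (\sum_(g <- s) g)%MM).
  rewrite -sz; elim: s Hs {sz sb degs} => [|g s IHs] Hs; first exact: mnm_pow0.
  rewrite big_cons mnm_pushD /= -add1n; apply: mnm_powD.
    exact/mnm_pow_gen/(HG _ (Hs _ (mem_head _ _))).2.
  by apply: IHs => h hs; apply: Hs; rewrite inE hs orbT.
rewrite -(submK sb) mnm_pushD addmA addmC; apply: mnm_powD => //.
apply: mnm_pow_cross; move: ab; rewrite -{1}(submK sb) mdegD degs; lia.
Qed.

End Cross.

(** * The join as a monomial ideal, and its normality *)

Section Join.
Variables (k : fieldType) (m n : nat).
Implicit Types (GI : set 'X_{1..m.+1}) (GJ : set 'X_{1..n.+1}).
Local Notation lft := (@lshift m.+1 n.+1).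
Local Notation rgt := (@rshift m.+1 n.+1).

Definition join_mnms GI GJ : set 'X_{1..m.+1 + n.+1} :=
  [set mnm_push lft a | a in GI] `|` [set mnm_push rgt b | b in GJ] `|`
  [set (U_(lft i) + U_(rgt j))%MM | i in setT & j in setT].

Lemma mnm_push_pull_split (e : 'X_{1..m.+1 + n.+1}) :
  e = (mnm_push lft (mnm_pull lft e) + mnm_push rgt (mnm_pull rgt e))%MM.
Proof.
apply/mnmP=> x; rewrite mnmDE !mnm_pushE.
case: (split_ordP x) => j ->.
  under [in RHS]eq_bigl do rewrite eq_lshift; rewrite big_pred1_eq mnmE.
  by rewrite big_pred0 ?addn0 // => i; apply: eq_rlshift.
rewrite big_pred0 ?add0n => [|i]; last exact: eq_lrshift.
by under eq_bigl do rewrite eq_rshift; rewrite big_pred1_eq mnmE.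
Qed.

Lemma pull_lft_rgt b : mnm_pull lft (mnm_push rgt b) = 0%MM.
Proof. by apply: mnm_pull_push0 => i j; rewrite eq_lrshift. Qed.

Lemma pull_rgt_lft a : mnm_pull rgt (mnm_push lft a) = 0%MM.
Proof. by apply: mnm_pull_push0 => i j; rewrite eq_rlshift. Qed.

(** The embeddings are ring morphisms taking monomials to renamed monomials, so preimages of ideals
    are ideals and only generators need checking. *)
Lemma join_ideal_genE GI GJ :
  join_ideal (ideal_gen (@mpolyXs k _ GI)) (ideal_gen (@mpolyXs k _ GJ)) =
  ideal_gen (@mpolyXs k _ (join_mnms GI GJ)).
Proof.
have xE a : xembed n ('X_[a] : {mpoly k[m.+1]}) = 'X_[mnm_push lft a].
  rewrite mnm_pushX /xembed comp_mpolyX.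
  by apply: eq_bigr => i _; rewrite tnth_mktuple.
have yE b : yembed m ('X_[b] : {mpoly k[n.+1]}) = 'X_[mnm_push rgt b].
  rewrite mnm_pushX /yembed comp_mpolyX.
  by apply: eq_bigr => i _; rewrite tnth_mktuple.
have LI := ideal_gen_ideal (@mpolyXs k _ (join_mnms GI GJ)).
apply/seteqP; split.
  apply: ideal_add_lub => //; first apply: ideal_add_lub => //.
  - apply: smallest_sub => // _ [f If <-]; move: f If; apply: smallest_sub.
      exact: (ideal_preimage (comp_mpoly _)).
    move=> _ [a Ia <-]; rewrite /mkset -/(xembed _ _) xE.
    by apply: sub_gen_smallest; eexists; last reflexivity; left; left; exists a.
  - apply: smallest_sub => // _ [f Jf <-]; move: f Jf; apply: smallest_sub.
      exact: (ideal_preimage (comp_mpoly _)).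
    move=> _ [b Jb <-]; rewrite /mkset -/(yembed _ _) yE.
    by apply: sub_gen_smallest; eexists; last reflexivity; left; right; exists b.
  - apply: smallest_sub => // _ [i _ [j _ <-]]; rewrite /xvar /yvar -mpolyXD.
    apply: sub_gen_smallest; eexists; last reflexivity.
    by right; exists i => //; exists j.
have gI := ideal_gen_ideal.
apply: smallest_sub; first by do 2 (apply: ideal_add_ideal => //).
move=> _ [_ [[[a Ia <-]|[b Jb <-]]|[i _ [j _ <-]]] <-].
- do 2 (apply: ideal_add_subl => //); apply: sub_gen_smallest.
  by exists 'X_[a]; rewrite ?xE //; apply: sub_gen_smallest; exists a.
- apply: ideal_add_subl => //; apply: ideal_add_subr => //; apply: sub_gen_smallest.
  by exists 'X_[b]; rewrite ?yE //; apply: sub_gen_smallest; exists b.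
- apply: ideal_add_subr; first exact: ideal_add_ideal.
  by apply: sub_gen_smallest; exists i => //; exists j => //; rewrite mpolyXD.
Qed.

(** [p1], [p2], [p3] count the factors from I, J and K. A factor from K adds one to both degrees;
    one from I or J affects only its own block. *)
Lemma join_mnms_split GI GJ t p e :
  (forall g, GI g -> mdeg g = t) -> (forall g, GJ g -> mdeg g = t) ->
  mnm_pow (join_mnms GI GJ) p e ->
  exists p1 p2 p3, [/\ p = (p1 + p2 + p3)%N,
    mnm_pow GI p1 (mnm_pull lft e), mnm_pow GJ p2 (mnm_pull rgt e),
    (t * p1 + p3 <= mdeg (mnm_pull lft e))%N &
    (t * p2 + p3 <= mdeg (mnm_pull rgt e))%N].
Proof.
move=> It Jt [s [<- Gs se]] {p}.
(* The product itself suffices: passing to a multiple preserves all the bounds. *)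
suff [p1 [p2 [p3 [E I1 J2 l1 r2]]]] : exists p1 p2 p3,
    [/\ size s = (p1 + p2 + p3)%N,
    mnm_pow GI p1 (mnm_pull lft (\sum_(g <- s) g)%MM),
    mnm_pow GJ p2 (mnm_pull rgt (\sum_(g <- s) g)%MM),
    (t * p1 + p3 <= mdeg (mnm_pull lft (\sum_(g <- s) g)%MM))%N &
    (t * p2 + p3 <= mdeg (mnm_pull rgt (\sum_(g <- s) g)%MM))%N].
  have le_l := mnm_pull_le lft se; have le_r := mnm_pull_le rgt se.
  exists p1, p2, p3; split=> //.
  - exact: mnm_pow_le le_l I1.
  - exact: mnm_pow_le le_r J2.
  - exact: leq_trans l1 (mdeg_le le_l).
  - exact: leq_trans r2 (mdeg_le le_r).
elim: s Gs {se} => [|g s IHs] Gs.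
  by exists 0%N, 0%N, 0%N; split; rewrite ?muln0 //; apply: mnm_pow0.
have [|p1 [p2 [p3 [E I1 J2 l1 r2]]]] := IHs.
  by move=> h hs; apply: Gs; rewrite inE hs orbT.
rewrite big_cons !mnm_pullD !mdegD /= E.
have [[[a Ia <-]|[b Jb <-]]|[i _ [j _ <-]]] := Gs _ (mem_head _ _).
- rewrite (mnm_pushK (@lshift_inj _ _)) pull_rgt_lft add0m mdeg0 It //.
  exists p1.+1, p2, p3; split=> //; last by rewrite mulnS; lia.
  by apply: (mnm_powD (p := 1)) => //; apply: mnm_pow_gen.
- rewrite (mnm_pushK (@rshift_inj _ _)) pull_lft_rgt add0m mdeg0 Jt //.
  exists p1, p2.+1, p3; split=> //; [lia| |by rewrite mulnS; lia].
  by apply: (mnm_powD (p := 1)) => //; apply: mnm_pow_gen.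
- rewrite -(mnm_pushU lft) -(mnm_pushU rgt) !mnm_pullD !mdegD.
  rewrite (mnm_pushK (@lshift_inj _ _)) pull_rgt_lft (mnm_pushK (@rshift_inj _ _)).
  rewrite pull_lft_rgt add0m addm0 mdeg0 !mdeg1.
  exists p1, p2, p3.+1; split; [lia| | |lia|lia].
  + exact: mnm_pow_le (leqnn _) (lem_addl _ _) I1.
  + exact: mnm_pow_le (leqnn _) (lem_addl _ _) J2.
Qed.

End Join.

(* At a maximum of p1 + p2 + p3 under these constraints one may take p1 = 0 and
   p3 = A, because trading a step of both p1 and p2 for t of p3 costs nothing
   when t >= 2. *)
Lemma join_exponents t q s A B p1 p2 p3 :
  (2 <= t)%N -> (0 < s)%N -> (A <= B)%N -> (q * s = p1 + p2 + p3)%N ->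
  (t * p1 + p3 <= A * s)%N -> (t * p2 + p3 <= B * s)%N ->
  ((q - A) * s <= p2)%N /\ (t * (q - A) + A <= B)%N.
Proof.
move=> t2 s_gt0 AB E h1 h2; have [qA|Aq] := leqP q A.
  by rewrite (eqP qA) mul0n muln0.
have [r qE] : exists r, q = (A + r)%N by exists (q - A)%N; lia.
subst q; rewrite addKn; have {}E : (A * s + r * s = p1 + p2 + p3)%N by lia.
(* As [p1 <= t * p1], the first degree bound gives [p1 + p3 <= A * s]. *)
split; first by nia.
rewrite -(leq_pmul2r s_gt0).
have [t' tE] : exists t', t = (t' + 2)%N by exists (t - 2)%N; lia.
(* Combining [t] times [E] with both degree bounds gives t r s + A s <= B s + t' (p3 - A s), where
   p3 <= A s. *)
have : (t' * p3 <= t' * (A * s))%N by rewrite leq_mul2l; apply/orP; right; lia.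
have := congr1 (muln t) E; subst t; nia.
Qed.

Theorem theorem13 (k : fieldType) (m n t : nat)
    (I : set {mpoly k[m.+1]}) (J : set {mpoly k[n.+1]}) :
  is_ideal I -> is_ideal J ->
  (2 <= t)%N ->
  gen_by_squarefree t I -> gen_by_squarefree t J ->
  normal_ideal I -> normal_ideal J ->
  normal_ideal (join_ideal I J).
Proof.
move=> _ _ t2 [GI It ->] [GJ Jt ->].
have {}It g : GI g -> mdeg g = t by case/It.
have {}Jt g : GJ g -> mdeg g = t by case/Jt.
rewrite -/(@mpolyXs k _ GI) -/(@mpolyXs k _ GJ) join_ideal_genE.
move=> /(normal_ideal_mnmP k (fun g Ig => eq_leq (It g Ig))) In.
move=> /(normal_ideal_mnmP k (fun g Jg => eq_leq (Jt g Jg))) Jn.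
pose L := join_mnms GI GJ.
have LI a : GI a -> L (mnm_push (@lshift _ _) a) by left; left; exists a.
have LJ b : GJ b -> L (mnm_push (@rshift _ _) b) by left; right; exists b.
have LK i j : L (U_(lshift n.+1 i) + U_(rshift m.+1 j))%MM.
  by right; exists i => //; exists j.
have Lt g : L g -> (mdeg g <= t)%N.
  case=> [[[a /It <- <-]|[b /Jt <- <-]]|[i _ [j _ <-]]]; rewrite ?mdeg_push //.
  (* Generators of K have degree 2, which is at most [t]. *)
  by rewrite mdegD !mdeg1.
apply/(normal_ideal_mnmP k Lt).
move=> q s e q_gt0 s_gt0 /(join_mnms_split It Jt)[p1 [p2 [p3 []]]].
rewrite [e in mnm_pow _ q e]mnm_push_pull_split !mnm_pullMn !mdegMn.
move: (mnm_pull _ e) (mnm_pull _ e) => b a E Ia Jb la lb.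
have [AB|/ltnW BA] := leqP (mdeg a) (mdeg b).
- have [rs rB] := join_exponents t2 s_gt0 AB E la lb.
  have Jr : mnm_pow GJ (q - mdeg a) b.
    (* The criterion concerns positive powers; the zeroth contains every monomial. *)
    have [->|r_gt0] := posnP (q - mdeg a); first exact: mnm_pow0.
    exact: Jn r_gt0 s_gt0 (mnm_pow_le rs (lepm_refl _) Jb).
  apply: mnm_pow_le (lepm_refl _) (mnm_pow_push_cross LK _ Jr rB); first lia.
  by move=> g Jg; split; [apply: Jt|apply: LJ].
(* The symmetric case, with x and y exchanged. *)
- have E' : (q * s = p2 + p1 + p3)%N by rewrite E (addnC p1).
  have [rs rA] := join_exponents t2 s_gt0 BA E' lb la.
  have Ir : mnm_pow GI (q - mdeg b) a.
    have [->|r_gt0] := posnP (q - mdeg b); first exact: mnm_pow0.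
    exact: In r_gt0 s_gt0 (mnm_pow_le rs (lepm_refl _) Ia).
  rewrite addmC; have KL j i : L (U_(rshift m.+1 j) + U_(lshift n.+1 i))%MM.
    by rewrite addmC.
  apply: mnm_pow_le (lepm_refl _) (mnm_pow_push_cross KL _ Ir rA); first lia.
  by move=> g Ig; split; [apply: It|apply: LI].
Qed.
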